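(* Let $\mathcal F$ be a family of non-empty subsets of a finite set $N$ covering $N$ that is closed under arbitrary unions, ordered by inclusion, and let $v$ be a capacity on $(\mathcal F,\subseteq)$. Then the following are equivalent: (i) $\int_{\mathcal F} f\,dv=\max\{\sum_{F\in\mathcal F}y_Fv(F)\mid y\in\mathbb R^{\mathcal F}_+,\ \sum_{F\in\mathcal F}y_F\mathbf 1_F\le f\}$ for all $f\in\mathbb R^N_+$; (ii) the functional $f\mapsto\int_{\mathcal F} f\,dv$ is superadditive on $\mathbb R^N_+$; (iii) $v$ is supermodular.
   Context: Index $\mathcal F=\{F_1,\dots,F_m\}$ so that $F_i\supseteq F_j$ implies $i\le j$. A capacity is $v:\mathcal F\to\mathbb R_+$ with $v(F)\le v(G)$ whenever $F\subseteq G$; set $v(\emptyset)=0$ and $\mathcal F_0=\mathcal F\cup\{\emptyset\}$, $\mathcal F_0(X)=\{F\in\mathcal F_0\mid F\subseteq X\}$. $F_i,F_j$ are co-intersecting if there is $k\le\min\{i,j\}$ with $F_k\cap F_i\ne\emptyset$ and $F_k\cap F_j\ne\emptyset$. $v$ is supermodular if for all co-intersecting $F,G\in\mathcal F$ there exist $F\wedge G,F\vee G\in\mathcal F_0(F\cup G)$ with $F\wedge G\subseteq F,G\subseteq F\vee G$ and $v(F\wedge G)+v(F\vee G)\ge v(F)+v(G)$. Simple functions: for $F\in\mathcal F$, $\zeta^F(G)=1$ iff $G\supseteq F$, else $0$; each $v:\mathcal F\to\mathbb R$ has a unique expansion $v=\sum_F\beta_F\zeta^F$. For a belief function ($\beta_F\ge0$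 for all $F$) and $f\in\mathbb R^N_+$: $\int_{\mathcal F} f\,dv:=\min\{\langle f,x\rangle\mid x\in\mathbb R^N_+,\ x(G)\ge v(G)\ \forall G\in\mathcal F\}$ with $x(G)=\sum_{i\in G}x_i$; for general $v$, $\int_{\mathcal F} f\,dv:=\int_{\mathcal F} f\,dv^+-\int_{\mathcal F} f\,dv^-$ where $v^+=\sum_{\beta_F\ge0}\beta_F\zeta^F$, $v^-=\sum_{\beta_F\le0}(-\beta_F)\zeta^F$. *)

(* Defs.v *)
From mathcomp Require Import boolp classical_sets reals.
From mathcomp Require Import all_boot all_order all_algebra.

Set Implicit Arguments.
Unset Strict Implicit.
Unset Printing Implicit Defensive.

Import Order.TTheory GRing.Theory Num.Theory.
Local Open Scope ring_scope.

(* The members of F, as a finType: functions on the family F are functions on *)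
(* [member F].                                                                *)
Notation member F := {G : {set _} | G \in F}.

Section Family.
Variables (N : finType) (F : {set {set N}}).

(* Since F consists of non-empty sets, only unions of non-empty subfamilies   *)
(* are required to be members.                                                *)
Definition union_closed : Prop :=
  forall S : {set {set N}}, S != finset.set0 -> S \subset F -> cover S \in F.

Definition decreasing_indexing (m : nat) (E : 'I_m -> member F) : Prop :=
  bijective E /\ (forall i j, val (E j) \subset val (E i) -> (i <= j)%N).

Definition co_intersecting (m : nat) (E : 'I_m -> member F) (i j : 'I_m) :
    Prop :=
  exists k : 'I_m, [/\ (k <= minn i j)%N,
    val (E k) :&: val (E i) != finset.set0 &
    val (E k) :&: val (E j) != finset.set0].

(* F_0(X) *)
Definition family0 (X : {set N}) : {set {set N}} :=
  finset (fun G => (G \in finset.set0 |: F) && (G \subset X)).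

Variable R : realType.
Implicit Types v : member F -> R.

Definition capacity v : Prop :=
  (forall G, 0 <= v G) /\
  (forall G H : member F, val G \subset val H -> v G <= v H).

(* v extended to F_0 by the value 0 at the empty set; the value 0 on the      *)
(* remaining sets is never used.                                              *)
Definition extend0 v (X : {set N}) : R := oapp v 0 (insub X).

Definition supermodular (m : nat) (E : 'I_m -> member F) v : Prop :=
  forall i j : 'I_m, co_intersecting E i j ->
  exists A B : {set N},
    [/\ A \in family0 (val (E i) :|: val (E j)),
        B \in family0 (val (E i) :|: val (E j)),
        A \subset val (E i) /\ A \subset val (E j),
        val (E i) \subset B /\ val (E j) \subset B &
        v (E i) + v (E j) <= extend0 v A + extend0 v B].

Definition zeta (H G : member F) : R := (val H \subset val G)%:R.

Definition is_expansion v (b : {ffun member F -> R}) : Prop :=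
  forall G, v G = \sum_(H : member F) b H * zeta H G.

Definition is_minimum (S : set R) (m : R) : Prop := S m /\ lbound S m.

Definition is_maximum (S : set R) (m : R) : Prop := S m /\ ubound S m.

Definition minimum (S : set R) : R := xget 0 (is_minimum S).

(* The unique expansion of v in simple functions, see [expansion_unique].     *)
Definition coeffs v : {ffun member F -> R} := xget 0 (is_expansion v).

Definition pos_part v (G : member F) : R :=
  \sum_(H : member F | 0 <= coeffs v H) coeffs v H * zeta H G.

Definition neg_part v (G : member F) : R :=
  \sum_(H : member F | coeffs v H <= 0) - coeffs v H * zeta H G.

(* For a belief function v on a family of non-empty sets and f >= 0, this is  *)
(* a feasible and bounded linear program, so its minimum exists and the       *)
(* default value in [minimum] plays no role.                                  *)
Definition belief_integral v (f : {ffun N -> R}) : R :=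
  minimum (fun c : R => exists x : {ffun N -> R},
    [/\ forall i, 0 <= x i,
        forall G : member F, v G <= \sum_(i in val G) x i &
        c = \sum_i f i * x i]).

Definition integral v (f : {ffun N -> R}) : R :=
  belief_integral (pos_part v) f - belief_integral (neg_part v) f.

Definition packing_values v (f : {ffun N -> R}) : set R :=
  fun c : R => exists y : {ffun member F -> R},
    [/\ forall G, 0 <= y G,
        forall i : N, \sum_(G : member F) y G * (i \in val G)%:R <= f i &
        c = \sum_(G : member F) y G * v G].

Definition superadditive (I : {ffun N -> R} -> R) : Prop :=
  forall f g : {ffun N -> R}, (forall i, 0 <= f i) -> (forall i, 0 <= g i) ->
    I f + I g <= I (f + g).

Lemma expansion_unique v : exists! b, is_expansion v b.
Proof.
have split_sum (b : {ffun member F -> R}) G :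
  \sum_(H : member F) b H * zeta H G =
  b G + \sum_(H : member F | val H \proper val G) b H.
  rewrite (bigID (fun H : member F => val H \subset val G)) /=.
  rewrite [X in _ + X]big1 ?addr0; last first.
    by move=> H /negbTE nHG; rewrite /zeta nHG mulr0.
  rewrite (bigD1 G) ?subxx //= /zeta subxx mulr1; congr (_ + _).
  apply: eq_big => [H|H /andP[-> _]]; last by rewrite mulr1.
  by rewrite properEneq andbC -(inj_eq val_inj).
have uniq_b (b c : {ffun member F -> R}) :
    is_expansion v b -> is_expansion v c -> b = c.
  move=> hb hc; apply/ffunP => G.
  have [n] := ubnP #|val G|; elim: n G => // n IHn G ltGn.
  have := hb G; rewrite hc !split_sum.
  have -> : \sum_(H : member F | val H \proper val G) c H =
            \sum_(H : member F | val H \proper val G) b H.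
    apply: eq_bigr => H /proper_card ltHG; symmetry; apply: IHn.
    exact: leq_trans ltHG _.
  by move/addIr.
suff [b hb] : exists b, is_expansion v b.
  by exists b; split=> // c hc; apply: uniq_b.
suff /(_ #|N|.+1) [b hb] : forall n, exists b : {ffun member F -> R},
    forall G : member F, (#|val G| < n)%N ->
      v G = \sum_(H : member F) b H * zeta H G.
  by exists b => G; apply: hb; rewrite ltnS max_card.
elim=> [|n [b hb]]; first by exists 0.
exists [ffun G : member F => if (#|val G| < n)%N then b G else
  v G - \sum_(H : member F | val H \proper val G) b H].
move=> G; rewrite ltnS => leGn; rewrite split_sum ffunE.
have -> : \sum_(H : member F | val H \proper val G)
    [ffun G0 : member F => if (#|val G0| < n)%N then b G0 else
      v G0 - \sum_(H0 : member F | val H0 \proper val G0) b H0] H =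
    \sum_(H : member F | val H \proper val G) b H.
  apply: eq_bigr => H /proper_card ltHG.
  by rewrite ffunE (leq_trans ltHG leGn).
case: ifP => [ltGn|_]; last by rewrite subrK.
by rewrite hb // split_sum.
Qed.

End Family.

(* Main.v *)
Require Import Defs.
From mathcomp Require Import boolp classical_sets reals.
From mathcomp Require Import all_boot all_order all_algebra.

Set Implicit Arguments.
Unset Strict Implicit.
Unset Printing Implicit Defensive.

Import Order.TTheory GRing.Theory Num.Theory.
Local Open Scope ring_scope.

(** Let [b] be the coefficients of [v] and [mass b S] the sum of [b H] over the
    members [H] contained in [S]; as F is union-closed, [mass b S] is the value
    of [v] at the largest member contained in [S].  If [f] is a nonnegative
    combination of indicators of its upper level sets [S], with weights [D S],
    then the integral of [f] is the Choquet sum of [D S * mass b S].  When [v]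
    is supermodular, so is [mass b], and Edmonds' greedy vector [x] dominates
    [mass b] with equality on the upper level sets of [f + g]; evaluating [f],
    [g] and [f + g] against [x] gives superadditivity.  The other implications
    evaluate the integral at multiples of indicators and at the sum of two
    indicators. *)

(** * Decomposition of a function along its upper level sets *)

Section SetFunctions.
Variables (N : finType) (R : realType).
Implicit Types (S U X Y P : {set N}) (f g x : {ffun N -> R}).

(** Strictness makes [U] an initial segment of every ordering of the points by decreasing [f],
    however ties are broken. *)
Definition strict_upset f U :=
  forall i j, i \in U -> j \notin U -> f j < f i.

(** The layer-cake decomposition behind the Choquet integral. The empty set may carry weight: this
    changes neither [f] nor a sum against a set function vanishing there. *)
Definition layering f (D : {set N} -> R) :=
  [/\ forall S, 0 <= D S,
      forall i, f i = \sum_S D S * (i \in S)%:R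
    & forall S, D S != 0 -> strict_upset f S].

(** Induction on the size of the support [P]: subtracting the least value of [f] on [P] from all of
    [P] removes a minimiser from the support. *)
Lemma layering_exists f : (forall i, 0 <= f i) -> exists D, layering f D.
Proof.
have [n] := ubnP #|[set i | 0 < f i]|; elim: n f => // n IHn f lt_n f0.
set P := [set i | 0 < f i] in lt_n.
have f_out i : i \notin P -> f i = 0.
  by rewrite inE lt_neqAle f0 andbT negbK => /eqP.
have [P0|/set0Pn[i0 Pi0]] := eqVneq P finset.set0.
  exists (fun=> 0); split=> // [i|S]; last by rewrite eqxx.
  by rewrite big1 => [|S _]; rewrite ?mul0r // f_out // P0 inE.
have [a Pa min_a] : exists2 a, a \in P & forall i, i \in P -> f a <= f i.
  by case: (arg_minP f Pi0) => a Pa min_a; exists a.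
have fa0 : 0 < f a by move: Pa; rewrite inE.
pose f' := [ffun i => f i - f a * (i \in P)%:R].
have f'0 i : 0 <= f' i.
  rewrite ffunE; have [Pi|Pi] := boolP (i \in P).
    by rewrite mulr1 subr_ge0 min_a.
  by rewrite mulr0 subr0.
have sub_f' i : 0 < f' i -> i \in P.
  rewrite ffunE; apply: contraTT => Pi.
  by rewrite (negbTE Pi) f_out // mulr0 subr0 ltxx.
have [|//|D [D0 fD upD]] := IHn f'.
  rewrite -ltnS; apply: leq_trans lt_n; rewrite ltnS; apply: proper_card.
  apply/properP; split.
    by apply/fintype.subsetP => i; rewrite inE; exact: sub_f'.
  by exists a; rewrite // inE ffunE Pa mulr1 subrr ltxx.
exists (fun S => D S + f a * (S == P)%:R); split=> [S|i|S].
- by rewrite addr_ge0 // mulr_ge0 // ltW.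
- under eq_bigr do rewrite mulrDl.
  rewrite big_split /= -fD (bigD1 P) //= eqxx mulr1 big1 ?addr0 => [|S].
    by rewrite ffunE subrK.
  by move=> /negbTE->; rewrite mulr0 mul0r.
- have [-> _ i j Pi Pj|_] := eqVneq S P.
    by rewrite f_out //; move: Pi; rewrite inE.
  rewrite mulr0 addr0 => /upD up i j Si Sj.
  (* A layer of [f'] that misses some point [j] lies inside [P], because [f' j] is nonnegative; on
     [P], [f] and [f'] differ by a constant. *)
  have lt_ji := up i j Si Sj; have Pi := sub_f' i (le_lt_trans (f'0 j) lt_ji).
  move: lt_ji; rewrite !ffunE Pi mulr1.
  have [Pj|Pj] := boolP (j \in P); first by rewrite mulr1 ltrD2r.
  by move=> _; rewrite (f_out j Pj); move: Pi; rewrite inE.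
Qed.

Lemma layering_scaled_indicator c P : 0 <= c ->
  layering [ffun i => c * (i \in P)%:R] (fun S => c * (S == P)%:R).
Proof.
move=> c0; split=> [S|i|S]; first by rewrite mulr_ge0.
- rewrite ffunE (bigD1 P) //= eqxx mulr1 big1 ?addr0 // => S /negbTE->.
  by rewrite mulr0 mul0r.
- rewrite mulf_eq0 negb_or pnatr_eq0 => /andP[cN0].
  have [-> _ i j Pi Pj|//] := eqVneq S P.
  by rewrite !ffunE Pi (negbTE Pj) mulr0 mulr1 lt_neqAle eq_sym cN0.
Qed.

(** Union and intersection form a chain, so they are the layers of this sum; this is how they enter
    the supermodular inequality. *)
Lemma layering_sum_indicators X Y :
  layering ([ffun i => (i \in X)%:R] + [ffun i => (i \in Y)%:R])
    (fun S => (S == X :|: Y)%:R + (S == X :&: Y)%:R).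
Proof.
split=> [S|i|S].
- by rewrite addr_ge0.
- under eq_bigr do rewrite mulrDl.
  have pick P : \sum_S (S == P)%:R * (i \in S)%:R = (i \in P)%:R :> R.
    rewrite (bigD1 P) //= eqxx mul1r big1 ?addr0 // => S /negbTE->.
    by rewrite mul0r.
  rewrite big_split /= !pick !ffunE !inE.
  by case: (i \in X); case: (i \in Y); rewrite ?addr0 ?add0r.
- move=> DS i j; rewrite !ffunE.
  have [-> |SU] := eqVneq S (X :|: Y).
    rewrite !inE; case: (i \in X); case: (i \in Y); case: (j \in X) => //;
    by case: (j \in Y) => //= _ _; rewrite ?addr0 ?add0r -?natrD ltr0n.
  have [-> |SI] := eqVneq S (X :&: Y).
    rewrite !inE; case: (i \in X); case: (i \in Y) => //; case: (j \in X) => //;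
    by case: (j \in Y) => //= _ _; rewrite -!natrD ltr_nat.
  by move: DS; rewrite (negbTE SU) (negbTE SI) addr0 eqxx.
Qed.

Lemma layering_pairing f D x : layering f D ->
  \sum_i f i * x i = \sum_S D S * \sum_(i in S) x i.
Proof.
case=> _ fD _; under eq_bigr do rewrite fD mulr_suml.
rewrite exchange_big; apply: eq_bigr => S _.
rewrite mulr_sumr [RHS]big_mkcond; apply: eq_bigr => i _.
by case: (i \in S); rewrite ?mulr1 // mulr0 mul0r.
Qed.

(** * Convex set functions and their core vectors *)

Definition convex_capacity (w : {set N} -> R) :=
  [/\ w finset.set0 = 0, forall X Y, X \subset Y -> w X <= w Y
    & forall X Y, w X + w Y <= w (X :|: Y) + w (X :&: Y)].

(* Edmonds' greedy vector: the elements of [P] are added one at a time, by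
   decreasing value of [f]. *)
Lemma core_vector_on w f P : convex_capacity w ->
  exists x, [/\ forall i, 0 <= x i,
    forall X, X \subset P -> w X <= \sum_(i in X) x i,
    \sum_(i in P) x i = w P
  & forall U, U \subset P -> strict_upset f U -> \sum_(i in U) x i = w U].
Proof.
case=> w0 w_mono w_super.
have [n] := ubnP #|P|; elim: n P => // n IHn P lt_n.
have [->|/set0Pn[i0 Pi0]] := eqVneq P finset.set0.
  exists 0; split=> [i|X||U]; first by rewrite ffunE.
    by rewrite subset0 => /eqP->; rewrite w0 big_set0.
    by rewrite w0 big_set0.
  by rewrite subset0 => /eqP-> _; rewrite w0 big_set0.
have [a Pa min_a] : exists2 a, a \in P & forall i, i \in P -> f a <= f i.
  by case: (arg_minP f Pi0) => a Pa min_a; exists a.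
have [|x [x0 x_ge x_tot x_eq]] := IHn (P :\ a).
  by move: lt_n; rewrite (cardsD1 a P) Pa ltnS.
(* The last point added receives its marginal value over the others. *)
pose z := [ffun i => if i == a then w P - w (P :\ a) else x i].
have zD1 X : \sum_(i in X :\ a) z i = \sum_(i in X :\ a) x i.
  by apply: eq_bigr => i; rewrite ffunE !inE => /andP[/negbTE->].
have zE X : a \in X ->
    \sum_(i in X) z i = w P - w (P :\ a) + \sum_(i in X :\ a) x i.
  by move=> Xa; rewrite (big_setD1 a) //= zD1 ffunE eqxx.
have zN X : a \notin X -> \sum_(i in X) z i = \sum_(i in X) x i.
  move=> Xa; apply: eq_bigr => i Xi; rewrite ffunE ifN //.
  by apply: contraNneq Xa => <-.
have D1_id X : a \notin X -> X \subset P -> X \subset P :\ a.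
  by move=> Xa XP; rewrite subsetD1 XP.
exists z; split=> [i|X XP||U UP upU].
- by rewrite ffunE; case: ifP => // _; rewrite subr_ge0 w_mono ?subD1set.
- have [Xa|Xa] := boolP (a \in X); last by rewrite zN // x_ge // D1_id.
  have XUP : X :|: P :\ a = P.
    apply/setP => i; rewrite !inE; have [->|_] := eqVneq i a.
      by rewrite Xa Pa.
    by rewrite /= orb_idl // => Xi; apply: (fintype.subsetP XP).
  have XIP : X :&: (P :\ a) = X :\ a.
    apply/setP => i; rewrite !inE andbCA; congr andb.
    by apply: andb_idr => Xi; apply: (fintype.subsetP XP).
  (* Increasing marginals: [a] adds at most as much to [X :\ a] as to [P :\ a]. *)
  have := w_super X (P :\ a); rewrite XUP XIP zE // => le_w.
  have le_x : w (X :\ a) <= \sum_(i in X :\ a) x i.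
    by rewrite x_ge // setSD.
  rewrite addrAC lerBrDr; apply: le_trans le_w _.
  by rewrite lerD2l.
- by rewrite zE // x_tot subrK.
- have [Ua|Ua] := boolP (a \in U); last by rewrite zN // x_eq // D1_id.
  (* Since [a] minimises [f] on [P], an upset containing [a] leaves out no point of [P]. *)
  have -> : U = P; last by rewrite zE // x_tot subrK.
  apply/eqP; rewrite eqEsubset UP; apply/fintype.subsetP => j Pj.
  by apply: contraT => /(upU a j Ua); rewrite ltNge min_a.
Qed.

(** The pairing splits over the layers, and the greedy vector is tight on every layer of nonzero
    weight. *)
Lemma core_vector w f D : convex_capacity w -> layering f D ->
  exists x, [/\ forall i, 0 <= x i,
    forall X, w X <= \sum_(i in X) x i
  & \sum_i f i * x i = \sum_S D S * w S].
Proof.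
move=> w_cvx fD.
have [x [x0 x_ge _ x_eq]] := core_vector_on f finset.setT w_cvx.
exists x; split=> // [X|]; first by rewrite x_ge ?subsetT.
rewrite (layering_pairing _ fD); apply: eq_bigr => S _.
have [->|DS] := eqVneq (D S) 0; first by rewrite !mul0r.
by case: fD => _ _ /(_ S DS) upS; rewrite x_eq ?subsetT.
Qed.

Lemma ler_layering_sum f D (w w' : {set N} -> R) : layering f D ->
  (forall S, w S <= w' S) -> \sum_S D S * w S <= \sum_S D S * w' S.
Proof. by case=> D0 _ _ le_w; apply: ler_sum => S _; apply: ler_wpM2l. Qed.

End SetFunctions.

(** * The largest member inside a set, and the mass of a set *)

Section Mass.
Variables (N : finType) (F : {set {set N}}) (R : realType).
Implicit Types (S X Y : {set N}) (f g : {ffun N -> R}).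
Implicit Types (v : member F -> R) (b : {ffun member F -> R}).

(** For a union-closed [F], the largest member inside [S], or the empty set if there is none. *)
Definition interior S : {set N} := cover [set H in F | H \subset S].

Definition mass b S : R := \sum_(H : member F | val H \subset S) b H.

Lemma interior_sub S : interior S \subset S.
Proof. by apply/bigcupsP => H; rewrite inE => /andP[]. Qed.

Lemma sub_interior H S : H \in F -> H \subset S -> H \subset interior S.
Proof. by move=> FH HS; apply: (bigcup_sup H); rewrite // inE FH. Qed.

Lemma interior_in S : union_closed F ->
  interior S \in (finset.set0 |: F)%SET.
Proof.
move=> ucF; rewrite !inE.
have [SE|nz] := eqVneq [set H in F | H \subset S] finset.set0.
  by rewrite /interior SE /cover big_set0 eqxx.
by rewrite ucF ?orbT //; apply/fintype.subsetP => H; rewrite inE => /andP[].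
Qed.

Lemma extend0_val v (G : member F) : extend0 v (val G) = v G.
Proof. by rewrite /extend0 valK. Qed.

Lemma extend0_set0 v : finset.set0 \notin F -> extend0 v finset.set0 = 0.
Proof. by move=> F0; rewrite /extend0 insubN. Qed.

Lemma extend0_mono v X Y : finset.set0 \notin F -> capacity v ->
  X \in (finset.set0 |: F)%SET -> Y \in (finset.set0 |: F)%SET ->
  X \subset Y -> extend0 v X <= extend0 v Y.
Proof.
move=> F0 [v0 v_mono].
have ge0 Z : 0 <= extend0 v Z by rewrite /extend0; case: insub => /=.
rewrite !in_setU1 => /predU1P[->|FX]; first by rewrite extend0_set0.
move=> /predU1P[->|FY].
  by rewrite subset0 => /eqP X0; rewrite -X0 FX in F0.
move=> XY; rewrite -[X]/(val (Sub X FX : member F)).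
by rewrite -[Y]/(val (Sub Y FY : member F)) !extend0_val v_mono.
Qed.

Lemma mass_val v b (G : member F) : is_expansion v b -> mass b (val G) = v G.
Proof.
move=> ->; rewrite /mass big_mkcond; apply: eq_bigr => H _.
by rewrite /zeta; case: (_ \subset _); rewrite ?mulr1 ?mulr0.
Qed.

Lemma mass_set0 b : finset.set0 \notin F -> mass b finset.set0 = 0.
Proof.
move=> F0; rewrite /mass big1 // => H; rewrite subset0 => /eqP H0.
by have := valP H; rewrite /= H0 (negbTE F0).
Qed.

(** The same members lie inside [S] and inside its interior, and on members [mass b] is the
    expansion of [v]. *)
Lemma massE v b S : finset.set0 \notin F -> union_closed F ->
  is_expansion v b -> mass b S = extend0 v (interior S).
Proof.
move=> F0 ucF vb.
have -> : mass b S = mass b (interior S).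
  apply: eq_bigl => H; apply/idP/idP => [|HS].
    by apply: sub_interior; exact: valP.
  exact: fintype.subset_trans HS (interior_sub S).
have := interior_in S ucF; rewrite in_setU1 => /predU1P[->|FS].
  by rewrite mass_set0 // extend0_set0.
rewrite -[interior S]/(val (Sub (interior S) FS : member F)).
by rewrite extend0_val (mass_val _ vb).
Qed.

(** Holds term by term: a member inside [X] or [Y] is inside the union, and one inside both is also
    inside the intersection. *)
Lemma belief_convex b : finset.set0 \notin F -> (forall H, 0 <= b H) ->
  convex_capacity (mass b).
Proof.
move=> F0 b0; split=> [|X Y XY|X Y]; first exact: mass_set0.
- rewrite /mass [leLHS]big_mkcond [leRHS]big_mkcond /=; apply: ler_sum => H _.
  case: ifP => [HX|_]; last by case: ifP.
  by rewrite (fintype.subset_trans HX XY).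
- rewrite /mass ![\sum_(_ | _ \subset _) _]big_mkcond /= -!big_split /=.
  apply: ler_sum => H _; rewrite subsetI.
  have [HX|_] := boolP (val H \subset X).
    by rewrite (fintype.subset_trans HX (subsetUl _ _)).
  have [HY|_] := boolP (val H \subset Y).
    by rewrite (fintype.subset_trans HY (subsetUr _ _)) addrC.
  by rewrite !addr0; case: ifP.
Qed.

(** The constraints concern members only; they reach [S] through its interior because [x] is
    nonnegative. *)
Lemma dominated_mass v b (x : {ffun N -> R}) S : finset.set0 \notin F ->
  union_closed F -> is_expansion v b -> (forall i, 0 <= x i) ->
  (forall G : member F, v G <= \sum_(i in val G) x i) ->
  mass b S <= \sum_(i in S) x i.
Proof.
move=> F0 ucF vb x0 x_ge; rewrite (massE _ _ _ vb) //.
have := interior_in S ucF; rewrite in_setU1 => /predU1P[->|FS].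
  by rewrite extend0_set0 // sumr_ge0.
rewrite -[interior S]/(val (Sub (interior S) FS : member F)) extend0_val.
apply: le_trans (x_ge _) _; rewrite [leRHS](big_setID (interior S)) /=.
rewrite (setIidPr (interior_sub S)).
by rewrite lerDl sumr_ge0.
Qed.

(** * Integrals as Choquet sums *)

(** The greedy core vector is feasible and attains the sum; every feasible vector dominates the mass
    layer by layer. *)
Lemma belief_integralE v b f D : finset.set0 \notin F -> union_closed F ->
  is_expansion v b -> (forall H, 0 <= b H) -> layering f D ->
  belief_integral v f = \sum_S D S * mass b S.
Proof.
move=> F0 ucF vb b0 fD; rewrite /belief_integral /minimum.
set A := (fun c => _).
have minA : is_minimum A (\sum_S D S * mass b S).
  split=> [|_ [x [x0 x_ge ->]]].
    have [x [x0 x_ge x_eq]] := core_vector (belief_convex F0 b0) fD.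
    by exists x; split=> // G; rewrite -(mass_val G vb).
  rewrite (layering_pairing _ fD); apply: (ler_layering_sum fD) => S.
  exact: dominated_mass vb x0 x_ge.
case: xgetP => [c _ [Ac lbc]|/(_ _ minA)//].
by case: minA => Am lbm; apply/eqP; rewrite eq_le lbc //= lbm.
Qed.

Lemma coeffsP v : is_expansion v (coeffs v).
Proof.
by have [b [vb _]] := expansion_unique v; apply: (xgetPex 0 (ex_intro _ b vb)).
Qed.

(** Both parts of [v] are belief functions, evaluated on the same layers, and mass is linear in the
    coefficients. *)
Lemma integralE v f D : finset.set0 \notin F -> union_closed F ->
  layering f D -> integral v f = \sum_S D S * mass (coeffs v) S.
Proof.
move=> F0 ucF fD; set b := coeffs v.
pose bp := [ffun H => if 0 <= b H then b H else 0].
pose bn := [ffun H => if b H <= 0 then - b H else 0].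
rewrite /integral (@belief_integralE _ bp f D) //; last 2 first.
- move=> G; rewrite /pos_part big_mkcond; apply: eq_bigr => H _.
  by rewrite ffunE; case: ifP; rewrite ?mul0r.
- by move=> H; rewrite ffunE; case: ifP.
rewrite (@belief_integralE _ bn f D) //; last 2 first.
- move=> G; rewrite /neg_part big_mkcond; apply: eq_bigr => H _.
  by rewrite ffunE; case: ifP; rewrite ?mul0r.
- by move=> H; rewrite ffunE; case: ifP; rewrite ?oppr_ge0.
rewrite -sumrB; apply: eq_bigr => S _; rewrite -mulrBr -sumrB.
congr (_ * _); apply: eq_bigr => H _; rewrite !ffunE.
by case: ltgtP => [||<-]; rewrite ?subr0 ?opprK ?add0r ?oppr0.
Qed.

Lemma integral_scaled_indicator v c (G : member F) : finset.set0 \notin F ->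
  union_closed F -> 0 <= c ->
  integral v [ffun i => c * (i \in val G)%:R] = c * v G.
Proof.
move=> F0 ucF c0.
rewrite (integralE _ F0 ucF (layering_scaled_indicator (val G) c0)).
rewrite (bigD1 (val G)) //= eqxx mulr1 (mass_val _ (coeffsP v)) big1 ?addr0 //.
by move=> S /negbTE->; rewrite mulr0 mul0r.
Qed.

Lemma integral_ge0 v f : finset.set0 \notin F -> union_closed F ->
  capacity v -> (forall i, 0 <= f i) -> 0 <= integral v f.
Proof.
move=> F0 ucF [v0 _] f0; have [D fD] := layering_exists f0.
rewrite (integralE _ F0 ucF fD) sumr_ge0 // => S _; apply: mulr_ge0.
  by case: fD.
rewrite (massE _ F0 ucF (coeffsP v)) /extend0.
by case: insub => /=.
Qed.

(** Moving the weight of each layer to its interior gives a packing below [f] with the value of the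
    Choquet sum. *)
Lemma integral_packing v f : finset.set0 \notin F -> union_closed F ->
  (forall i, 0 <= f i) -> packing_values v f (integral v f).
Proof.
move=> F0 ucF f0; have [D fD] := layering_exists f0.
pose y := [ffun G : member F => \sum_(S | interior S == val G) D S].
(* Used with [h] a point indicator for feasibility and with [h = v] for the value. A layer whose
   interior is no member feeds no [y G], matching the value 0 of [extend0]. *)
have sum_y (h : member F -> R) : \sum_G y G * h G =
    \sum_S D S * extend0 h (interior S).
  under eq_bigr do rewrite ffunE big_mkcond mulr_suml /=.
  rewrite exchange_big; apply: eq_bigr => S _ /=.
  rewrite /extend0; case: insubP => [G FG valG|notF] /=.
    rewrite (bigD1 G) //= valG eqxx big1 ?addr0 // => H HG.
    by rewrite -valG (inj_eq val_inj) eq_sym (negbTE HG) mul0r.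
  rewrite mulr0 big1 // => G _; rewrite ifN ?mul0r //.
  by apply: contraNneq notF => ->; exact: valP.
case: (fD) => D0 fE _; exists y; split=> [G|i|].
- by rewrite ffunE sumr_ge0.
- rewrite (sum_y (fun G => (i \in val G)%:R)) fE; apply: ler_sum => S _.
  apply: ler_wpM2l => //; rewrite /extend0.
  case: insubP => [G _ valG|_] //=.
  rewrite ler_nat valG; case iS: (i \in interior S) => //.
  by rewrite (fintype.subsetP (interior_sub S) _ iS).
- rewrite sum_y (integralE _ F0 ucF fD); apply: eq_bigr => S _.
  by rewrite (massE _ F0 ucF (coeffsP v)).
Qed.

(** * Implications between the three conditions *)

(** Optimal packings for [f] and [g] add up to a packing for [f + g]. *)
Lemma maximum_superadditive v :
  (forall f, (forall i, 0 <= f i) ->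
     is_maximum (packing_values v f) (integral v f)) ->
  superadditive (integral v).
Proof.
move=> max_v f g f0 g0.
have [[y [y0 yf ->]] _] := max_v f f0; have [[z [z0 zg ->]] _] := max_v g g0.
have fg0 i : 0 <= (f + g) i by rewrite ffunE addr_ge0.
have [_ ub] := max_v _ fg0; apply: ub.
exists (y + z); split=> [G|i|]; first by rewrite ffunE addr_ge0.
- under eq_bigr do rewrite ffunE mulrDl.
  by rewrite big_split ffunE lerD.
- by rewrite -big_split; apply: eq_bigr => G _; rewrite ffunE mulrDl.
Qed.

Lemma superadditive_maximum v f : finset.set0 \notin F -> union_closed F ->
  capacity v -> superadditive (integral v) -> (forall i, 0 <= f i) ->
  is_maximum (packing_values v f) (integral v f).
Proof.
move=> F0 ucF cap_v supI f0; split; first exact: integral_packing.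
move=> _ [y [y0 yf ->]].
pose ind (G : member F) : {ffun N -> R} := [ffun i => y G * (i \in val G)%:R].
have ind0 G i : 0 <= ind G i by rewrite ffunE mulr_ge0.
have sumE : \sum_G y G * v G = \sum_G integral v (ind G).
  by apply: eq_bigr => G _; rewrite integral_scaled_indicator.
have le_sum : \sum_G integral v (ind G) <= integral v (\sum_G ind G).
  (* Nonnegativity is carried through the induction, as superadditivity is available for nonnegative
     functions only. *)
  have [] // : (forall i, 0 <= (\sum_G ind G) i) /\
    \sum_G integral v (ind G) <= integral v (\sum_G ind G).
  apply: (big_ind2 (fun (c : R) (h : {ffun N -> R}) =>
    (forall i, 0 <= h i) /\ c <= integral v h))
    => [|c h d k [h0 ch] [k0 dk]|G _].
  - have z0 i : 0 <= (0 : {ffun N -> R}) i by rewrite ffunE.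
    by split=> //; apply: integral_ge0.
  - split=> [i|]; first by rewrite ffunE addr_ge0.
    by apply: le_trans (supI _ _ h0 k0); rewrite lerD.
  - by split.
rewrite sumE; apply: le_trans le_sum _.
have s0 i : 0 <= (\sum_G ind G) i by rewrite sum_ffunE sumr_ge0.
have d0 i : 0 <= (f - \sum_G ind G) i.
  rewrite !ffunE sum_ffunE subr_ge0; apply: le_trans (yf i).
  by apply: ler_sum => G _; rewrite ffunE.
(* Split [f] into the packed part and the slack, whose integral is nonnegative. *)
rewrite -[f in leRHS](subrK (\sum_G ind G)) addrC.
by apply: le_trans (supI _ _ s0 d0); rewrite lerDl integral_ge0.
Qed.

Lemma convex_superadditive v : finset.set0 \notin F -> union_closed F ->
  convex_capacity (mass (coeffs v)) -> superadditive (integral v).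
Proof.
move=> F0 ucF w_cvx f g f0 g0.
have [D fD] := layering_exists f0; have [D' gD] := layering_exists g0.
have [|D'' fgD] := @layering_exists _ _ (f + g).
  by move=> i; rewrite ffunE addr_ge0.
(* One vector serves all three functions: tight on the layers of [f + g], dominating on those of [f]
   and [g]. *)
have [x [x0 x_ge x_eq]] := core_vector w_cvx fgD.
rewrite !(integralE _ F0 ucF fD, integralE _ F0 ucF gD, integralE _ F0 ucF fgD).
rewrite -x_eq; under [leRHS]eq_bigr do rewrite ffunE mulrDl.
rewrite big_split /= (layering_pairing _ fD) (layering_pairing _ gD).
by apply: lerD; [apply: (ler_layering_sum fD)|apply: (ler_layering_sum gD)].
Qed.

Lemma superadditive_supermodular v m (E : 'I_m -> member F) :
  finset.set0 \notin F -> union_closed F ->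
  superadditive (integral v) -> supermodular E v.
Proof.
move=> F0 ucF supI i j _.
set X := val (E i); set Y := val (E j).
have FU : X :|: Y \in F.
  have -> : X :|: Y = cover [set X; Y].
    by rewrite /cover bigcup_setU !big_set1.
  rewrite ucF //; first by apply/set0Pn; exists X; rewrite !inE eqxx.
  by apply/fintype.subsetP => H; rewrite !inE => /orP[]/eqP->; apply: valP.
(* The intersection need not be a member; its interior carries the same mass. *)
exists (interior (X :&: Y)), (X :|: Y); split.
- rewrite inE interior_in //=.
  by rewrite (fintype.subset_trans (interior_sub _)) // subIset // subsetUl.
- by rewrite inE in_setU1 FU orbT /=.
- by have := interior_sub (X :&: Y); rewrite subsetI => /andP.
- by rewrite subsetUl subsetUr.
pose one (Z : {set N}) : {ffun N -> R} := [ffun i => (i \in Z)%:R].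
have oneE (G : member F) : integral v (one (val G)) = v G.
  rewrite -[RHS]mul1r -integral_scaled_indicator ?ler01 //; congr integral.
  by apply/ffunP => k; rewrite !ffunE mul1r.
have one0 Z k : 0 <= one Z k by rewrite ffunE.
have := supI _ _ (one0 X) (one0 Y); rewrite !oneE => /le_trans; apply.
rewrite (integralE _ F0 ucF (layering_sum_indicators _ X Y)).
under eq_bigr do rewrite mulrDl.
have pick P : \sum_S (S == P)%:R * mass (coeffs v) S = mass (coeffs v) P.
  rewrite (bigD1 P) //= eqxx mul1r big1 ?addr0 // => S /negbTE->.
  by rewrite mul0r.
rewrite big_split /= !pick -(massE _ F0 ucF (coeffsP v)) addrC lerD2l.
rewrite -[X :|: Y]/(val (Sub (X :|: Y) FU : member F)) extend0_val.
by rewrite (mass_val _ (coeffsP v)).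
Qed.

(* The whole ground set is a member and comes first in the indexing, so any two
   members are co-intersecting. *)
Lemma all_co_intersecting m (E : 'I_m -> member F) i j :
  finset.set0 \notin F -> cover F = finset.setT -> union_closed F ->
  decreasing_indexing E -> co_intersecting E i j.
Proof.
move=> F0 covF ucF [[E' EK E'K] E_dec].
have FT : finset.setT \in F.
  rewrite -covF ucF //; apply/set0Pn; exists (val (E i)); exact: valP.
have memb_neq0 (G : member F) : val G != finset.set0.
  by apply: contraNneq F0 => <-; exact: valP.
exists (E' (Sub finset.setT FT)); rewrite E'K /= !setTI !memb_neq0; split=> //.
by rewrite leq_min; apply/andP; split; apply: E_dec; rewrite E'K subsetT.
Qed.

(** Supermodularity is applied to the interiors of [X] and [Y]; the resulting sets lie inside
    [X :&: Y] and [X :|: Y], whose masses bound their values. If an interior is empty, monotonicity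
    suffices. *)
Lemma supermodular_convex v m (E : 'I_m -> member F) :
  finset.set0 \notin F -> cover F = finset.setT -> union_closed F ->
  decreasing_indexing E -> capacity v -> supermodular E v ->
  convex_capacity (mass (coeffs v)).
Proof.
move=> F0 covF ucF decE cap_v superE.
have wE S : mass (coeffs v) S = extend0 v (interior S).
  exact: massE (coeffsP v).
have le_w A S : A \in (finset.set0 |: F)%SET -> A \subset S ->
    extend0 v A <= mass (coeffs v) S.
  move=> FA AS; rewrite wE extend0_mono ?interior_in //.
  move: FA; rewrite in_setU1 => /predU1P[->|FA]; first exact: sub0set.
  exact: sub_interior.
have w_mono X Y : X \subset Y -> mass (coeffs v) X <= mass (coeffs v) Y.
  move=> XY; rewrite wE le_w ?interior_in //.
  exact: fintype.subset_trans (interior_sub X) XY.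
have w0 := mass_set0 (coeffs v) F0.
have w_ge0 S : 0 <= mass (coeffs v) S by rewrite -w0 w_mono // sub0set.
split=> // X Y.
have := interior_in X ucF; rewrite in_setU1 => /predU1P[X0|FX].
  rewrite (wE X) X0 extend0_set0 // add0r.
  by rewrite -[leLHS]addr0 lerD // w_mono // subsetUr.
have := interior_in Y ucF; rewrite in_setU1 => /predU1P[Y0|FY].
  rewrite (wE Y) Y0 extend0_set0 // addr0.
  by rewrite -[leLHS]addr0 lerD // w_mono // subsetUl.
have [[E' EK E'K] _] := decE.
pose GX : member F := Sub (interior X) FX.
pose GY : member F := Sub (interior Y) FY.
have co_XY := all_co_intersecting (E' GX) (E' GY) F0 covF ucF decE.
have [A [B []]] := superE _ _ co_XY.
rewrite !E'K /= !(wE X, wE Y) => /setIdP[FA _] /setIdP[FB BXY] [AX AY] _.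
rewrite -(extend0_val v GX) -(extend0_val v GY) /= => /le_trans; apply.
rewrite addrC lerD // le_w //.
  apply: fintype.subset_trans BXY _.
  by rewrite setUSS ?interior_sub.
rewrite subsetI (fintype.subset_trans AX (interior_sub X)) /=.
exact: fintype.subset_trans AY (interior_sub Y).
Qed.

End Mass.

Theorem theorem5 (R : realType) (N : finType) (F : {set {set N}})
  (nonempty_members : finset.set0 \notin F)
  (covering : cover F = finset.setT)
  (union_closed_F : union_closed F)
  (m : nat) (E : 'I_m -> member F) (indexing_E : decreasing_indexing E)
  (v : member F -> R) (capacity_v : capacity v) :
  ((forall f : {ffun N -> R}, (forall i, 0 <= f i) ->
      is_maximum (packing_values v f) (integral v f))
   <-> superadditive (integral v))
  /\
  (superadditive (integral v) <-> supermodular E v).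
Proof.
split; split.
- exact: maximum_superadditive.
- by move=> supI f; apply: superadditive_maximum.
- exact: superadditive_supermodular.
- move=> superE; apply: convex_superadditive => //.
  exact: supermodular_convex superE.
Qed.
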